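(* Let $n\ge5$ and let $A\in\mathbb{R}^{n\times n}$ be the clamped-free matrix defined in the context. Then $$\|A^{-1}\|_1=\frac{n^4-n^2}{8},\qquad \|A^{-1}\|_\infty=\frac{n^4+n^2}{8}.$$
   Context: The clamped-free matrix $A=[a_{i,j}]_{i,j=1}^n$ (for an integer $n\ge5$) is the pentadiagonal matrix whose nonzero entries are: main diagonal: $a_{1,1}=7$, $a_{i,i}=6$ for $2\le i\le n-2$, $a_{n-1,n-1}=5$, $a_{n,n}=2$; first superdiagonal: $a_{i,i+1}=-4$ for $1\le i\le n-2$, $a_{n-1,n}=-2$; first subdiagonal: $a_{i,i-1}=-4$ for $2\le i\le n$; second superdiagonal: $a_{i,i+2}=1$ for $1\le i\le n-2$; second subdiagonal: $a_{i,i-2}=1$ for $3\le i\le n-1$, $a_{n,n-2}=2$. All other entries are $0$. The matrix $A$ is nonsingular. $\|\cdot\|_1$ is the maximum absolute column sum and $\|\cdot\|_\infty$ the maximum absolute row sum of a matrix. *)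

(* Defs.v *)
From HB Require Import structures.
From mathcomp Require Import all_boot all_order all_algebra.
Set Implicit Arguments.
Unset Strict Implicit.
Unset Printing Implicit Defensive.
Import Order.TTheory GRing.Theory Num.Theory.
Local Open Scope ring_scope.

(* The indices [i] and [j] are 1-based, [1 <= i, j <= n] with [n >= 5]. *)
Definition clamped_free_entry (R : pzRingType) (n i j : nat) : R :=
  if j == i then
    if i == 1%N then 7
    else if (i <= n - 2)%N then 6
    else if i == (n - 1)%N then 5
    else 2
  else if j == (i + 1)%N then
    if (i <= n - 2)%N then - 4 else - 2
  else if i == (j + 1)%N then - 4
  else if j == (i + 2)%N then 1
  else if i == (j + 2)%N then
    if (i <= n - 1)%N then 1 else 2
  else 0.

Definition clamped_free (R : pzRingType) (n : nat) : 'M[R]_n :=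
  \matrix_(i < n, j < n) clamped_free_entry R n i.+1 j.+1.

(* The sums are nonnegative, so 0 is a neutral starting value for the maxima. *)
Definition mxnorm1 (R : realDomainType) (m n : nat) (A : 'M[R]_(m, n)) : R :=
  \big[Num.max/0]_(j < n) \sum_(i < m) `|A i j|.

Definition mxnormoo (R : realDomainType) (m n : nat) (A : 'M[R]_(m, n)) : R :=
  \big[Num.max/0]_(i < m) \sum_(j < n) `|A i j|.

(* Main.v *)
Require Import Defs.
From HB Require Import structures.
From mathcomp Require Import all_boot all_order all_algebra.
From mathcomp Require Import zify ring lra.
Set Implicit Arguments.
Unset Strict Implicit.
Unset Printing Implicit Defensive.
Import Order.TTheory GRing.Theory Num.Theory.
Local Open Scope ring_scope.

(** The matrix is the finite-difference model of a cantilever beam (fourth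
derivative), clamped at the node 0 and free at the node n, and its inverse can
be written down from statics.

For a deflection u with u(0) = 0, let the moment be M(i) = u(i-1) - 2 u(i) +
u(i+1) for 0 < i < n, with M(0) = 2 u(1) at the clamp (the reflected ghost value
u(-1) = u(1)) and M(i) = 0 from the free end on. Every row i < n of the matrix
is then the second difference M(i-1) - 2 M(i) + M(i+1), boundary rows included,
and the row n is 2 M(n-1) ([clamped_free_entryE]). A load at the node j has the
moment (j - i)^+, whose second difference in i is the unit mass at j; the
deflection with this moment is the Green function
  G(i, j) = i j / 2 + sum_(1 <= k < n) (i - k)^+ (j - k)^+
([green_moment]). The factor 2 in the last row is compensated by halving the
last column, so the inverse has entries G(i, j) w(j), where w(n) = 1/2 and all
other weights are 1 ([mul_clamped_free_green]).

These entries are nonnegative and G is increasing in both arguments, so the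
absolute values disappear and the extremal row and column dominate all the
others entry by entry. The largest row is the last one. The largest column is
the one of index n - 1: because of its weight 1/2, the last column is dominated
by it as well ([green_tip_column]).

It remains to sum over i or j and then over k. Put l = n - k. In the last row,
w is a trapezoidal weight, so the ramp (j - k)^+ sums to l^2 / 2 and the row sum
is n^3 / 4 + sum_l l^3 / 2. In the column n - 1, the ramp (i - k)^+ sums to
l (l + 1) / 2, which leads to the sum of (l - 1) l (l + 1) / 2. Both are
polynomials in n. *)

(** Coefficient of u(j) in the moment M(i). Since j >= 1 in all uses, the
coefficient of u(0) = 0 drops out at i = 1 without a separate case. *)
Definition moment_entry (R : pzRingType) (n i j : nat) : R :=
  if i == 0%N then 2 * (j == 1%N)%:R
  else if (i < n)%N then
    (j == i.-1)%:R - 2 * (j == i)%:R + (j == i.+1)%:R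
  else 0.

Ltac decide_indices :=
  repeat match goal with
  | |- context [@eq_op ?T ?a ?b] =>
      first [ have -> : @eq_op T a b = true by lia
            | have -> : @eq_op T a b = false by lia ]
  | |- context [leq ?a ?b] =>
      first [ have -> : leq a b = true by lia
            | have -> : leq a b = false by lia ]
  end.

(** The fourth difference is the second difference of moments. Row 1
deviates from the interior stencil because M(0) = 2 u(1) at the clamp, and row
n - 1 because M(n) = 0 at the free end. *)
Lemma clamped_free_entryE (R : comNzRingType) (n i j : nat) :
    (5 <= n)%N -> (i < n)%N -> (j < n)%N ->
  clamped_free_entry R n i.+1 j.+1 =
  if i.+1 == n then 2 * moment_entry R n i j.+1
  else moment_entry R n i j.+1 - 2 * moment_entry R n i.+1 j.+1
       + moment_entry R n i.+2 j.+1.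
Proof.
move=> hn hi hj; rewrite /clamped_free_entry /moment_entry.
(* Once the row type and the offset j - i are known, every test is decided. *)
have hrow : [|| i == 0, i == 1, (1 < i) && (i.+2 < n), i.+2 == n | i.+1 == n]%N.
  by lia.
have hcol : [|| j == i, j == i.+1, j == i.+2, j.+1 == i, j.+2 == i
  | (i.+2 < j) || (j.+2 < i)]%N by lia.
case/or4P: hrow => [?|?|?|/orP[?|?]];
  case/or4P: hcol => [?|?|?|/or3P[?|?|?]];
  first [exfalso; lia | decide_indices; rewrite /=; ring].
Qed.

Lemma sum_delta (R : pzRingType) (n a : nat) (u : nat -> R) :
    u 0%N = 0 -> (a <= n)%N ->
  \sum_(k < n) (k.+1 == a)%:R * u k.+1 = u a.
Proof.
case: a => [|a] u0 lean.
  by rewrite u0 big1 // => k _; rewrite mul0r.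
rewrite (bigD1 (Ordinal lean)) //= eqxx mul1r big1 ?addr0 // => k.
by rewrite -val_eqE /= eqSS => /negPf ->; rewrite mul0r.
Qed.

Lemma sum_moment_entry (R : comNzRingType) (n i : nat) (u : nat -> R) :
    u 0%N = 0 -> (0 < n)%N ->
  \sum_(k < n) moment_entry R n i k.+1 * u k.+1 =
  if i == 0%N then 2 * u 1%N
  else if (i < n)%N then u i.-1 - 2 * u i + u i.+1 else 0.
Proof.
move=> u0 n0; rewrite /moment_entry; case: eqP => [_|i0].
  rewrite -(sum_delta u0 n0) mulr_sumr; apply: eq_bigr => k _; exact/esym/mulrA.
case: ltnP => lein; last by rewrite big1 // => k _; rewrite mul0r.
rewrite -(sum_delta u0 lein) -(sum_delta u0 (ltnW lein)).
have /(sum_delta u0) <- : (i.-1 <= n)%N by lia.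
rewrite mulr_sumr -sumrN -!big_split /=.
by apply: eq_bigr => k _; ring.
Qed.

(** Deflection at i of the beam loaded at j, as the work of the two moments
(i - k)^+ and (j - k)^+ summed over the nodes k; the clamp carries half the
weight of an interior node, hence the term i j / 2. Truncated subtraction is
the positive part. *)
Definition green (R : unitRingType) (n i j : nat) : R :=
  (i * j)%:R / 2 + \sum_(1 <= k < n) ((i - k) * (j - k))%:R.

Definition end_weight (R : unitRingType) (n j : nat) : R :=
  if j == n then 2^-1 else 1.

Lemma green0 (R : unitRingType) n j : green R n 0 j = 0.
Proof. by rewrite /green mul0r big1 ?addr0 // => k _; rewrite sub0n. Qed.

Lemma green1 (R : unitRingType) n j : green R n 1 j = j%:R / 2.
Proof.
rewrite /green mul1n big_nat big1 ?addr0 // => k /andP[k1 _].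
by have -> : (1 - k = 0)%N by lia.
Qed.

(** The second difference of the ramp i |-> (i - k)^+ is the unit mass at k, so
it selects the term k = i of the sum; the bilinear term i j / 2 is affine in i. *)
Lemma green_bending (R : realFieldType) (n i j : nat) :
    (0 < i < n)%N ->
  green R n i.-1 j - 2 * green R n i j + green R n i.+1 j = (j - i)%:R.
Proof.
move=> hi; rewrite /green.
set S := \sum_(1 <= k < n) ((i.-1 - k) * _)%:R.
set T := \sum_(1 <= k < n) ((i - k) * _)%:R.
set U := \sum_(1 <= k < n) ((i.+1 - k) * _)%:R.
have -> : U = (j - i)%:R + 2 * T - S.
  have -> : (j - i)%:R = \sum_(1 <= k < n) ((k == i) * (j - k))%:R :> R.
    rewrite (bigD1_seq i) ?iota_uniq //=; last by rewrite mem_index_iota.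
    rewrite eqxx mul1n big1 ?addr0 // => k /negPf ->.
    by rewrite mul0n.
  rewrite mulr_sumr -sumrN -!big_split /=; apply: eq_bigr => k _.
  apply/eqP; rewrite eq_sym subr_eq; apply/eqP.
  rewrite -natrM -!natrD; congr (_%:R).
  rewrite mulnA -!mulnDl; congr (_ * _)%N; lia.
have -> : i = i.-1.+1 by lia.
rewrite /= !natrM -!natr1; by field.
Qed.

(** The moment of a load at j is (j - i)^+ at all nodes i, the clamp and the
free end included: beyond the free end it vanishes because j <= n. *)
Lemma green_moment (R : realFieldType) (n i j : nat) :
    (0 < n)%N -> (j <= n)%N ->
  \sum_(k < n) moment_entry R n i k.+1 * green R n k.+1 j = (j - i)%:R.
Proof.
move=> n0 lejn; rewrite (@sum_moment_entry _ _ _ (fun k => green R n k j)) ?green0 //.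
case: eqP => [->|i0]; first by rewrite green1 subn0; field.
case: ltnP => lein; first by rewrite green_bending //; lia.
by have -> : (j - i = 0)%N by lia.
Qed.

(** The second difference of i |-> (j - i)^+ is the unit mass at j. In the last
row, twice the moment (j - (n - 1))^+ is 2 for j = n and 0 otherwise, and the
weight 1/2 normalizes it. *)
Lemma clamped_free_green (R : realFieldType) (n i j : nat) :
    (5 <= n)%N -> (i < n)%N -> (j < n)%N ->
  \sum_(k < n) clamped_free_entry R n i.+1 k.+1
               * (green R n k.+1 j.+1 * end_weight R n j.+1) = (i == j)%:R.
Proof.
move=> hn hi hj; have n0 : (0 < n)%N by lia.
have mom m := @green_moment R n m j.+1 n0 hj.
under eq_bigr => k _ do rewrite mulrA clamped_free_entryE //.
rewrite -mulr_suml /end_weight; case: (i.+1 =P n) => [ein|nin].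
  under eq_bigr => k _ do rewrite -mulrA.
  rewrite -mulr_sumr mom -ein eqSS (eq_sym i).
  case: eqP => [->|/eqP nij]; first by rewrite subSnn /=; field.
  have -> : (j.+1 - i = 0)%N by lia.
  by rewrite mulr0 mul0r.
have -> : \sum_(k < n) (moment_entry R n i k.+1
      - 2 * moment_entry R n i.+1 k.+1 + moment_entry R n i.+2 k.+1)
      * green R n k.+1 j.+1 =
   (j.+1 - i)%:R - 2 * (j.+1 - i.+1)%:R + (j.+1 - i.+2)%:R.
  rewrite -!mom mulr_sumr -sumrN -!big_split /=.
  by apply: eq_bigr => k _; ring.
have -> : (j.+1 - i)%:R - 2 * (j.+1 - i.+1)%:R + (j.+1 - i.+2)%:R
    = (i == j)%:R :> R.
  rewrite -natrM addrAC -natrD; apply/eqP; rewrite subr_eq -natrD.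
  by rewrite eqr_nat; lia.
by case: (i =P j) => [<-|_]; rewrite ?mul0r // mul1r; case: eqP.
Qed.

Definition green_mx (R : unitRingType) n : 'M[R]_n :=
  \matrix_(i < n, j < n) (green R n i.+1 j.+1 * end_weight R n j.+1).

Lemma mul_clamped_free_green (R : realFieldType) n :
  (5 <= n)%N -> clamped_free R n *m green_mx R n = 1%:M.
Proof.
move=> hn; apply/matrixP => i j; rewrite !mxE.
under eq_bigr => k _ do rewrite !mxE.
exact: clamped_free_green.
Qed.

Lemma green_ge0 (R : realFieldType) n i j : 0 <= green R n i j.
Proof. by rewrite addr_ge0 ?divr_ge0 ?sumr_ge0. Qed.

Lemma end_weight_ge0 (R : realFieldType) n j : 0 <= end_weight R n j.
Proof. by rewrite /end_weight; case: ifP => _; rewrite ?invr_ge0. Qed.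

Lemma le_green (R : realFieldType) n i i' j j' :
  (i <= i')%N -> (j <= j')%N -> green R n i j <= green R n i' j'.
Proof.
move=> hi hj; apply: lerD; first by rewrite ler_pM2r ?invr_gt0 ?ltr0n // ler_nat leq_mul.
by apply: ler_sum => k _; rewrite ler_nat leq_mul // leq_sub2r.
Qed.

(** Halving a term (i - k)(n - k) of the sum gives at most (i - k)(n - 1 - k),
except at k = n - 1, where the latter is 0 and the former at most 1/2. This
excess is absorbed by i (n - 1) / 2 - i n / 4, which is at least 1/2. *)
Lemma green_tip_column (R : realFieldType) n i :
  (4 <= n)%N -> (0 < i <= n)%N -> green R n i n / 2 <= green R n i n.-1.
Proof.
move=> hn hi; rewrite /green.
set S := \sum_(1 <= k < n) ((i - k) * (n - k))%:R.
set T := \sum_(1 <= k < n) ((i - k) * (n.-1 - k))%:R.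
have hST : S <= 2 * T + 1.
  have -> : 2 * T + 1 = 2 * T + \sum_(1 <= k < n) (k == n.-1)%:R.
    congr (_ + _); apply/esym.
    rewrite (bigD1_seq n.-1) ?iota_uniq ?mem_index_iota //=; last by lia.
    by rewrite eqxx big1 ?addr0 // => k /negPf ->.
  rewrite mulr_sumr -big_split /= /S [leLHS]big_nat [leRHS]big_nat.
  apply: ler_sum => k hk; rewrite -natrM -natrD ler_nat.
  case: eqP => [->|nk]; last by rewrite addn0 mulnCA leq_mul2l; lia.
  have -> : (n - n.-1 = 1)%N by lia.
  lia.
have hin : (i * n + 2)%:R <= (2 * (i * n.-1))%:R :> R.
  by rewrite ler_nat; nia.
rewrite natrD [X in _ <= X]natrM in hin; lra.
Qed.

Lemma sum_ramp (R : realFieldType) n k : (k <= n)%N ->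
  \sum_(i < n) (i.+1 - k)%:R = (n - k)%:R * ((n - k)%:R + 1) / 2 :> R.
Proof.
elim: n => [|n IH] hk; first by rewrite big_ord0 sub0n !mul0r.
rewrite big_ord_recr /=; case: (ltnP n k) => hnk.
  have -> : (n.+1 - k = 0)%N by lia.
  rewrite big1 ?mul0r ?addr0 // => i _.
  by have -> : (i.+1 - k = 0)%N by have := ltn_ord i; lia.
by rewrite IH // subSn // -natr1; field.
Qed.

(** The weight is that of the trapezoidal rule, which is exact on a function
that is affine between the nodes, so the sum is the area of a triangle. *)
Lemma sum_weighted_ramp (R : realFieldType) n k : (0 < n)%N -> (k <= n)%N ->
  \sum_(j < n) (j.+1 - k)%:R * end_weight R n j.+1 = (n - k)%:R ^+ 2 / 2 :> R.
Proof.
move=> n0 hk; have := sum_ramp R hk.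
case: n n0 hk => // n _ hk; rewrite !big_ord_recr /= /end_weight eqxx => h.
under eq_bigr => i _ do rewrite eqSS ltn_eqF ?ltn_ord // mulr1.
by apply: (addIr ((n.+1 - k)%:R / 2)); rewrite -addrA -splitr h; field.
Qed.

Lemma sum_nat_rev_sub (R : realFieldType) (F : nat -> R) n :
  \sum_(1 <= k < n) F (n - k)%N = \sum_(1 <= k < n) F k.
Proof.
rewrite big_nat_rev /= big_nat [RHS]big_nat; apply: eq_bigr => k hk.
by congr F; lia.
Qed.

Lemma green_column_sum (R : realFieldType) n : (0 < n)%N ->
  \sum_(i < n) green R n i.+1 n.-1 = (n%:R ^+ 4 - n%:R ^+ 2) / 8 :> R.
Proof.
move=> n0; rewrite /green big_split /= exchange_big /=.
have -> : \sum_(i < n) (i.+1 * n.-1)%:R / 2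
    = n%:R * (n%:R + 1) / 2 * (n%:R - 1) / 2 :> R.
  have := sum_ramp R (leq0n n); rewrite subn0 => <-; rewrite !mulr_suml.
  by apply: eq_bigr => i _; rewrite subn0 natrM -subn1 natrB.
under eq_big_nat => k hk.
  under eq_bigr => i _ do rewrite natrM.
  rewrite -mulr_suml sum_ramp; last by lia.
  have -> : (n.-1 - k)%:R = (n - k)%:R - 1 :> R.
    by apply/eqP; rewrite eq_sym subr_eq natr1 eqr_nat; lia.
  over.
rewrite (@sum_nat_rev_sub _ (fun l => l%:R * (l%:R + 1) / 2 * (l%:R - 1))).
have -> : \sum_(1 <= l < n) l%:R * (l%:R + 1) / 2 * (l%:R - 1)
    = (n%:R + 1) * n%:R * (n%:R - 1) * (n%:R - 2) / 8 :> R.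
  case: n n0 => // n _; elim: n => [|n IH]; first by rewrite big_geq //; ring.
  by rewrite big_nat_recr //= IH -!natr1; by field.
by field.
Qed.

Lemma green_row_sum (R : realFieldType) n : (0 < n)%N ->
  \sum_(j < n) green R n n j.+1 * end_weight R n j.+1
  = (n%:R ^+ 4 + n%:R ^+ 2) / 8 :> R.
Proof.
move=> n0; rewrite /green.
under eq_bigr => j _ do rewrite mulrDl mulr_suml.
rewrite big_split /= exchange_big /=.
have -> : \sum_(j < n) (n * j.+1)%:R / 2 * end_weight R n j.+1
    = n%:R / 2 * (n%:R ^+ 2 / 2) :> R.
  have := sum_weighted_ramp R n0 (leq0n n); rewrite subn0 => <-; rewrite mulr_sumr.
  by apply: eq_bigr => i _; rewrite subn0 natrM; ring.
under eq_big_nat => k hk.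
  under eq_bigr => i _ do rewrite natrM -mulrA.
  rewrite -mulr_sumr sum_weighted_ramp //; last by lia.
  over.
rewrite (@sum_nat_rev_sub _ (fun l => l%:R * (l%:R ^+ 2 / 2))).
have -> : \sum_(1 <= l < n) l%:R * (l%:R ^+ 2 / 2)
    = n%:R ^+ 2 * (n%:R - 1) ^+ 2 / 8 :> R.
  case: n n0 => // n _; elim: n => [|n IH]; first by rewrite big_geq //; ring.
  by rewrite big_nat_recr //= IH -!natr1; by field.
by field.
Qed.

Lemma bigmax_eq_ord (R : realDomainType) n (F : 'I_n -> R) (m : 'I_n) :
  (forall i, F i <= F m) -> 0 <= F m -> \big[Num.max/0]_(i < n) F i = F m.
Proof.
move=> hF h0; apply/eqP; rewrite eq_le le_bigmax_cond // andbT.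
by apply/bigmax_leP.
Qed.

Theorem theorem2p4 (R : realFieldType) (n : nat) (hn : (5 <= n)%N) :
  [/\ clamped_free R n \in unitmx,
      mxnorm1 (invmx (clamped_free R n)) = (n%:R ^+ 4 - n%:R ^+ 2) / 8
    & mxnormoo (invmx (clamped_free R n)) = (n%:R ^+ 4 + n%:R ^+ 2) / 8].
Proof.
have AG := mul_clamped_free_green R hn.
have [uA _] := mulmx1_unit AG.
have -> : invmx (clamped_free R n) = green_mx R n.
  by rewrite -[RHS](mulKmx uA) AG mulmx1.
have n0 : (0 < n)%N by lia.
have absG i j : `|green_mx R n i j| = green R n i.+1 j.+1 * end_weight R n j.+1.
  by rewrite mxE ger0_norm // mulr_ge0 ?green_ge0 ?end_weight_ge0.
split=> //.
- have hm : (n.-2 < n)%N by lia.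
  have e : n.-2.+1 = n.-1 by lia.
  rewrite /mxnorm1 (@bigmax_eq_ord _ _ _ (Ordinal hm)); last exact: sumr_ge0.
    rewrite -green_column_sum //; apply: eq_bigr => i _.
    by rewrite absG /= e /end_weight ltn_eqF ?mulr1 //; lia.
  move=> j; apply: ler_sum => i _; rewrite !absG /= e /end_weight.
  rewrite [n.-1 == n]ltn_eqF ?mulr1; last by lia.
  case: eqP => [->|/eqP nj]; first by apply: green_tip_column; have := ltn_ord i; lia.
  by rewrite mulr1; apply: le_green => //; have := ltn_ord j; lia.
- have hm : (n.-1 < n)%N by lia.
  rewrite /mxnormoo (@bigmax_eq_ord _ _ _ (Ordinal hm)); last exact: sumr_ge0.
    rewrite -green_row_sum //; apply: eq_bigr => j _.
    by rewrite absG /= prednK.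
  move=> i; apply: ler_sum => j _; rewrite !absG /= prednK //.
  by rewrite ler_wpM2r ?end_weight_ge0 // le_green //.
Qed.
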